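(* Let $G=(V,E)$ be a graph containing a cycle and let $x$ be an extreme point of the strong density polyhedron $P_{SD}(G)$. Then there exists $u\in V$ such that $x_u\ge 1/2$.
   Context: Graphs are finite, undirected, simple and loopless. For $S\subseteq V$, $G[S]$ is the subgraph induced by $S$, $E[S]$ is its edge set, and $d_S(u)$ is the degree of $u\in S$ in $G[S]$. The strong density polyhedron is $$P_{SD}(G)=\Big\{x\in[0,1]^V:\ \sum_{u\in S}(d_S(u)-1)x_u\ \ge\ |E[S]|-|S|+1\quad\text{for all } S\subseteq V \text{ with } E[S]\neq\emptyset\Big\}.$$ *)

(* Defs.v *)
From mathcomp Require Import all_boot all_order all_algebra.
Set Implicit Arguments.
Unset Strict Implicit.
Unset Printing Implicit Defensive.
Import Order.TTheory GRing.Theory Num.Theory.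
Local Open Scope ring_scope.

Record sgraph (V : finType) := SGraph {
  adj :> rel V;
  adj_sym : symmetric adj;
  adj_irr : irreflexive adj }.

(* Edges are unordered pairs {u, v}, so each edge is counted once. *)
Definition induced_edges (V : finType) (G : sgraph V) (S : {set V})
  : {set {set V}} :=
  [set [set p.1; p.2] | p in [pred p : V * V |
     [&& p.1 \in S, p.2 \in S & G p.1 p.2]]].

Definition induced_degree (V : finType) (G : sgraph V) (S : {set V}) (u : V)
  : nat :=
  #|[set v in S | G u v]|.

(* The length bound excludes the walk u, v, u, which is a [ucycle] of a
   symmetric relation. *)
Definition has_cycle (V : finType) (G : sgraph V) : Prop :=
  exists2 c : seq V, ucycle G c & (2 < size c)%N.

(* Coefficients and right-hand sides are computed in R, not with truncated
   subtraction: both can be negative. *)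
Definition strong_density (R : realFieldType) (V : finType) (G : sgraph V)
    (x : {ffun V -> R^o}) : Prop :=
  (forall u, 0 <= x u <= 1) /\
  (forall S : {set V}, induced_edges G S != set0 ->
     #|induced_edges G S|%:R - #|S|%:R + 1
       <= \sum_(u in S) ((induced_degree G S u)%:R - 1) * x u).

Definition extreme_point (R : realFieldType) (L : lmodType R) (P : L -> Prop)
    (x : L) : Prop :=
  P x /\
  (forall (y z : L) (t : R), P y -> P z -> 0 < t < 1 ->
     x = t *: y + (1 - t) *: z -> y = x /\ z = x).

(* Main.v *)
(* Suppose x u < 1/2 everywhere. Give the edge uv the weight 1 - x u - x v > 0
   and the vertex u the cost 1 - x u > 1/2. The density constraint for S reads
   weight(E[S]) <= cost(S) - 1, and it holds for every S of cost at least 1;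
   weight is supermodular and cost is modular, so two tight sets whose
   intersection has cost at least 1 uncross, with no edge between the two
   differences. A set of cost < 1 is empty or a single vertex u with x u > 0.

   Let P be the support of x. By induction on T, the tight constraints inside T,
   restricted to the coordinates in P, have rank at most max(0, |T & P| - 2).
   Take a maximal tight proper subset A of T, together with the maximal tight
   sets meeting A in cost < 1. These sets pairwise meet in cost < 1, so their
   edge sets are disjoint and summing weights gives
     sum_u (mult u - 1) (1 - x u) <= (number of sets) - 1.
   Since 1 - x u > 1/2, this bounds the sum of their ranks, plus one for T itself,
   as soon as two of the sets have at least two vertices in P. Otherwise the
   constraint of T is redundant: either some edge of T lies in none of the sets,
   and T is A uncrossed with that edge, or the displayed inequality is an
   equality, which forces T & P to be empty.

   Hence for T = V the rank is smaller than |P|, and x can be moved in both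
   directions along some nonzero vector supported on P. *)
Require Import Defs.
From mathcomp Require Import all_boot all_order all_algebra.
From mathcomp Require Import zify ring lra.
Import Order.TTheory GRing.Theory Num.Theory.
Local Open Scope ring_scope.

Set Implicit Arguments.
Unset Strict Implicit.
Unset Printing Implicit Defensive.

(** * Modularity of sums and of induced degrees *)

Lemma sum_setUI (R : realFieldType) (V : finType) (A B : {set V}) (f : V -> R) :
  \sum_(u in A :|: B) f u + \sum_(u in A :&: B) f u
    = \sum_(u in A) f u + \sum_(u in B) f u.
Proof.
rewrite !(big_mkcond (fun u => u \in _)) -!big_split /=; apply: eq_bigr => u _.
by rewrite !inE; case: (u \in A); case: (u \in B); rewrite /= ?addr0 ?add0r.
Qed.

Section Degree.
Variables (R : realFieldType) (V : finType) (G : sgraph V).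
Implicit Types (S A B : {set V}) (u v : V).

Local Notation deg := (induced_degree G).

Lemma induced_degreeE S u : deg S u = #|S :&: [set v | G u v]|.
Proof. by apply: eq_card => v; rewrite !inE. Qed.

Lemma induced_degree_sum S u : deg S u = (\sum_v ((v \in S) && G u v : nat))%N.
Proof.
rewrite /induced_degree -sum1_card big_mkcond; apply: eq_bigr => v _.
by rewrite inE; case: ifP.
Qed.

Lemma induced_degreeUI A B u :
  (deg (A :|: B) u + deg (A :&: B) u = deg A u + deg B u)%N.
Proof. by rewrite !induced_degreeE setIUl setIIl cardsUI. Qed.

Lemma induced_degreeUD A B u :
  deg (A :|: B) u = (deg A u + deg (B :\: A) u)%N.
Proof.
have := induced_degreeUI A (B :\: A) u.
have -> : A :|: B :\: A = A :|: B.
  by apply/setP=> v; rewrite !inE; case: (v \in A).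
have -> : A :&: (B :\: A) = set0.
  by apply/setP=> v; rewrite !inE; case: (v \in A).
by rewrite [deg set0 u]induced_degreeE set0I cards0 addn0.
Qed.

Lemma induced_degree_gt0 S u v : v \in S -> G u v -> (0 < deg S u)%N.
Proof. by move=> Sv Guv; apply/card_gt0P; exists v; rewrite inE Sv. Qed.

Lemma induced_degree_edge u v : G u v -> deg [set u; v] u = 1%N.
Proof.
move=> Guv; apply/eqP/cards1P; exists v; apply/setP=> w; rewrite !inE.
have [->|wv] := eqVneq w v; first by rewrite Guv orbT.
by case: eqVneq => // ->; rewrite adj_irr.
Qed.

Lemma handshake S : (#|induced_edges G S| * 2 = \sum_(u in S) deg S u)%N.
Proof.
pose Q := [pred p : V * V | [&& p.1 \in S, p.2 \in S & G p.1 p.2]].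
transitivity #|Q|; last first.
  rewrite -sum1_card (eq_bigl (fun p : V * V =>
    (p.1 \in S) && ((p.2 \in S) && G p.1 p.2))) //.
  rewrite -(pair_big_dep (fun u => u \in S) (fun u v => (v \in S) && G u v)
    (fun _ _ => 1%N)) /=.
  apply: eq_bigr => u _; rewrite /induced_degree -sum1_card.
  by apply: eq_bigl => v; rewrite inE.
rewrite -[#|Q|]sum1_card (partition_big_imset (fun p : V * V => [set p.1; p.2])) /=.
rewrite -sum_nat_const; apply: eq_bigr => e /imsetP[[u v] /= /and3P[Su Sv Guv] ->].
have uv : u != v by apply: contraTneq Guv => ->; rewrite adj_irr.
rewrite sum1dep_card.
(* The fibre over an edge consists of its two orientations, which differ because [G] is
   irreflexive. *)
have -> : [set p : V * V | Q p & [set p.1; p.2] == [set u; v]] = [set (u, v); (v, u)].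
  apply/setP => -[a b]; rewrite !inE /= !xpair_eqE; apply/idP/idP.
    case/andP=> /and3P[Sa Sb Gab] /eqP E.
    have ab : a != b by apply: contraTneq Gab => ->; rewrite adj_irr.
    have := set21 a b; have := set22 a b; rewrite E !inE.
    case/orP=> /eqP Eb /orP[] /eqP Ea; subst; rewrite ?eqxx ?orbT //;
      by rewrite eqxx in ab.
  case/orP=> /andP[/eqP-> /eqP->]; first by rewrite Su Sv Guv eqxx.
  by rewrite Su Sv adj_sym Guv setUC eqxx.
by rewrite cards2 xpair_eqE (negPf uv).
Qed.

(** Extended by 0 outside [S], so that coefficients of different constraints can be added vertex by
    vertex. *)
Definition coef S u : R := if u \in S then (deg S u)%:R - 1 else 0.

(* The degree of [u] in the bipartite graph between [A :\: B] and [B :\: A]. *)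
Definition cross A B u : nat :=
  if u \in A :\: B then deg (B :\: A) u
  else if u \in B :\: A then deg (A :\: B) u else 0.

(** At a vertex of [A :\: B], the union adds to the neighbours in [A] exactly those in [B :\: A],
    and symmetrically. At every other vertex the coefficients are modular. *)
Lemma coefUI A B u :
  coef (A :|: B) u + coef (A :&: B) u = coef A u + coef B u + (cross A B u)%:R.
Proof.
rewrite /coef /cross !inE.
have /(congr1 (fun n => n%:R : R)) := induced_degreeUI A B u; rewrite !natrD => E.
have /(congr1 (fun n => n%:R : R)) := induced_degreeUD A B u; rewrite !natrD => EA.
have /(congr1 (fun n => n%:R : R)) := induced_degreeUD B A u; rewrite !natrD setUC => EB.
by case: (u \in A); case: (u \in B) => /=; lra.
Qed.

Lemma cross_eq0 A B : (forall u, cross A B u = 0%N) ->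
  forall u v, u \in A :\: B -> v \in B :\: A -> ~~ G u v.
Proof.
move=> c0 u v uA vB; apply/negP => Guv.
by have := induced_degree_gt0 vB Guv; have := c0 u; rewrite /cross uA => ->.
Qed.

End Degree.

Lemma ltr_sum_one (R : numDomainType) (I : finType) (P : pred I) (f g : I -> R) (i : I) :
  P i -> (forall j, P j -> f j <= g j) -> f i < g i ->
  \sum_(j | P j) f j < \sum_(j | P j) g j.
Proof.
move=> Pi le_fg lt_fg; rewrite (bigD1 i) //= [ltRHS](bigD1 i) //=.
by apply: ltr_leD => //; apply: ler_sum => j /andP[/le_fg].
Qed.

(** * Weight, cost and tight sets *)

Section Weights.
Variables (R : realFieldType) (V : finType) (G : sgraph V) (x : V -> R).
Implicit Types (A B S T : {set V}) (F : {set {set V}}) (u v : V).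

Definition cost S : R := \sum_(u in S) (1 - x u).

(* Each edge [uv] of [G[S]] contributes [1 - x u - x v], split between its two
   ends. *)
Definition weight S : R :=
  \sum_(u in S) (induced_degree G S u)%:R * (2^-1 - x u).

(** By [slackE], equality in the density constraint of [S]. An edgeless set of cost 1 also counts as
    tight, although the polyhedron has no constraint for it. *)
Definition tight S := weight S == cost S - 1.

Definition pos_set : {set V} := [set u | 0 < x u].

Lemma costUI A B : cost (A :|: B) + cost (A :&: B) = cost A + cost B.
Proof. exact: sum_setUI. Qed.

Lemma weightE S :
  weight S = \sum_u coef R G S u * (2^-1 - x u) + \sum_(u in S) (2^-1 - x u).
Proof.
rewrite /weight !(big_mkcond (fun u => u \in S)) -big_split /=.
by apply: eq_bigr => u _; rewrite /coef; case: ifP => _; ring.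
Qed.

Lemma weightUI A B : weight (A :|: B) + weight (A :&: B)
  = weight A + weight B + \sum_u (cross G A B u)%:R * (2^-1 - x u).
Proof.
have := sum_setUI A B (fun u => 2^-1 - x u); rewrite !weightE.
suff : \sum_u coef R G (A :|: B) u * (2^-1 - x u)
      + \sum_u coef R G (A :&: B) u * (2^-1 - x u)
    = \sum_u coef R G A u * (2^-1 - x u) + \sum_u coef R G B u * (2^-1 - x u)
      + \sum_u (cross G A B u)%:R * (2^-1 - x u) by lra.
by rewrite -!big_split; apply: eq_bigr => u _ /=; rewrite -!mulrDl coefUI.
Qed.

(** By [handshake], the number of edges is half the degree sum; the two sides then agree vertex by
    vertex. *)
Lemma slackE S : cost S - 1 - weight S =
  \sum_(u in S) ((induced_degree G S u)%:R - 1) * x u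
    - (#|induced_edges G S|%:R - #|S|%:R + 1).
Proof.
have /(congr1 (fun n => n%:R : R)) := handshake G S.
rewrite natrM natr_sum => E.
have -> : #|induced_edges G S|%:R
    = \sum_(u in S) (induced_degree G S u)%:R * 2^-1 :> R.
  by rewrite -mulr_suml -E; field.
rewrite -sum1_card natr_sum /cost /weight.
set A := \sum_(u in S) _ * x u; set B := \sum_(u in S) _ * 2^-1.
set C := \sum_(u in S) 1%:R; set D := \sum_(u in S) (1 - _).
set E' := \sum_(u in S) _.
suff : D - E' = A - (B - C) by lra.
rewrite /A /B /C /D /E' -!sumrB; apply: eq_bigr => u _; by field.
Qed.

(** The index set, all ordered adjacent pairs, does not depend on [S], so weights of different sets
    can be compared pair by pair. *)
Lemma weight_pairs S : weight S =
  \sum_u \sum_(v | G u v) ((u \in S) && (v \in S))%:R * (2^-1 - x u).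
Proof.
rewrite /weight big_mkcond; apply: eq_bigr => u _.
rewrite -mulr_suml; case: ifP => uS /=; last by rewrite big1 ?mul0r.
congr (_ * _); rewrite induced_degree_sum natr_sum [RHS]big_mkcond.
by apply: eq_bigr => v _; case: (G u v); rewrite ?andbT ?andbF.
Qed.

Section Half.
Hypotheses (x_ge0 : forall u, 0 <= x u) (x_lt : forall u, x u < 2^-1).

Lemma cost_gt0 u : 0 < 1 - x u.
Proof. by have := x_lt u; lra. Qed.

Lemma cost_sub A B : A \subset B -> cost A <= cost B.
Proof.
move=> /subsetP sAB; rewrite /cost [leRHS](big_setID A) /=.
have -> : B :&: A = A by apply/setIidPr/subsetP.
by rewrite lerDl sumr_ge0 // => u _; rewrite ltW ?cost_gt0.
Qed.

Lemma cost_lt1_eq S u v : cost S < 1 -> u \in S -> v \in S -> u = v.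
Proof.
move=> cS uS vS; apply/eqP; apply: contraTT cS => uv; rewrite -leNgt.
apply: le_trans (cost_sub (A := [set u; v]) _); last first.
  by apply/subsetP=> w; rewrite !inE => /orP[] /eqP->.
rewrite /cost big_setU1 ?inE //= big_set1.
by have := x_lt u; have := x_lt v; lra.
Qed.

Lemma cost_lt1_pos S u : cost S < 1 -> u \in S -> u \in pos_set.
Proof.
move=> cS uS; rewrite inE lt_def x_ge0 andbT; apply: contraTneq cS => xu.
rewrite -leNgt; apply: le_trans (cost_sub (A := [set u]) _).
  by rewrite /cost big_set1 xu; lra.
by rewrite sub1set.
Qed.

Lemma weight_ge0 S : 0 <= weight S.
Proof.
apply: sumr_ge0 => u _; apply: mulr_ge0; first exact: ler0n.
by have := x_lt u; lra.
Qed.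

Lemma tight_cost S : tight S -> 1 <= cost S.
Proof. by move=> /eqP E; have := weight_ge0 S; lra. Qed.

Lemma weight_edgeless S : {in S &, forall u v, ~~ G u v} -> weight S = 0.
Proof.
move=> nG; apply: big1 => u uS; rewrite /induced_degree.
rewrite (_ : [set _ | _] = set0) ?cards0 ?mul0r //.
by apply/setP=> v; rewrite !inE; apply/negP => /andP[vS]; apply/negP/nG.
Qed.

(** Weight 0 forces cost exactly 1. A vertex with [0 < x u] alone costs less than 1, and any second
    vertex brings the cost above 1. *)
Lemma tight_edgeless S : tight S -> {in S &, forall u v, ~~ G u v} ->
  S :&: pos_set = set0.
Proof.
move=> /eqP tS /weight_edgeless wS; apply/setP=> u; rewrite !inE.
apply/negP=> /andP[uS xu].
have /cost_sub c1 : [set u] \subset S by rewrite sub1set.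
have c0 : cost S = 1 by lra.
have : S \subset [set u].
  apply/subsetP=> v vS; rewrite inE; apply: contraT => vu.
  have /cost_sub : [set u; v] \subset S.
    by apply/subsetP=> w; rewrite !inE => /orP[] /eqP->.
  rewrite {1}/cost big_setU1 ?inE 1?eq_sym //= big_set1.
  by have := x_lt u; have := x_lt v; lra.
by move=> /cost_sub; rewrite {2}/cost big_set1; lra.
Qed.

(** The density constraint of a single edge reads 0 >= 0. *)
Lemma tight_edge u v : G u v -> tight [set u; v].
Proof.
move=> Guv; have uv : u != v by apply: contraTneq Guv => ->; rewrite adj_irr.
rewrite /tight /weight /cost !big_setU1 ?inE //= !big_set1 (induced_degree_edge Guv).
by rewrite setUC induced_degree_edge 1?adj_sym //; apply/eqP; field.
Qed.

Hypothesis weight_le : forall S, 1 <= cost S -> weight S <= cost S - 1.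

(** The slacks of union and intersection are nonnegative, and by [costUI] and [weightUI] they add up
    to minus the cross sum, whose terms are nonnegative. So all of these vanish, and each factor
    [2^-1 - x u] is positive. *)
Lemma tight_uncross A B : tight A -> tight B -> 1 <= cost (A :&: B) ->
  [/\ tight (A :|: B), tight (A :&: B) & forall u, cross G A B u = 0%N].
Proof.
move=> /eqP tA /eqP tB cI.
have cU : 1 <= cost (A :|: B).
  apply: le_trans (cost_sub (A := A) _); last exact: subsetUl.
  by apply: tight_cost; apply/eqP.
have wU := weight_le cU; have wI := weight_le cI.
have cUI := costUI A B; have wUI := weightUI A B.
have y_gt0 u : 0 < 2^-1 - x u by have := x_lt u; lra.
have X_ge0 u : 0 <= (cross G A B u)%:R * (2^-1 - x u).
  by rewrite mulr_ge0 ?ler0n ?ltW.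
have X_ge : 0 <= \sum_u (cross G A B u)%:R * (2^-1 - x u) by apply: sumr_ge0.
split; try (by apply/eqP; lra).
have X0 : \sum_u (cross G A B u)%:R * (2^-1 - x u) == 0 by apply/eqP; lra.
move: X0; rewrite psumr_eq0 // => /allP X0 u; apply/eqP.
have := X0 u (mem_index_enum u); rewrite /= mulf_eq0 pnatr_eq0.
by rewrite (gt_eqF (y_gt0 u)) orbF.
Qed.

(** * Families of tight sets with small pairwise intersections *)

Section Packing.
Variable F : {set {set V}}.
Hypothesis F_tight : {in F, forall S, tight S}.
Hypothesis F_disj : {in F &, forall A B, A != B -> cost (A :&: B) < 1}.
Hypothesis F_neq0 : F != set0.

Definition mult u := #|[set S in F | u \in S]|.

(** Two members sharing both ends of an edge would meet in at least two vertices, hence in cost at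
    least 1. *)
Lemma mult_pair u v : G u v ->
  (\sum_(S in F) ((u \in S) && (v \in S) : nat)
    <= ((u \in cover F) && (v \in cover F)))%N.
Proof.
move=> Guv; have uv : u != v by apply: contraTneq Guv => ->; rewrite adj_irr.
have [/existsP[S /and3P[SF uS vS]] | /existsPn nS] :=
  boolP [exists S, [&& S \in F, u \in S & v \in S]]; last first.
  rewrite big1 // => S SF; have := nS S; rewrite SF /=.
  by case: (_ && _).
rewrite (bigD1 S) //= big1 ?addn0 => [|B /andP[BF BS]].
  rewrite uS vS; have sc : S \subset cover F by apply: bigcup_sup.
  by rewrite !(subsetP sc).
apply/eqP; rewrite eqb0; apply: contra uv => /andP[uB vB]; apply/eqP.
by apply: cost_lt1_eq (F_disj BF SF BS) _ _; rewrite inE ?uB ?vB.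
Qed.

Lemma sum_weight_pairs : \sum_(S in F) weight S =
  \sum_u \sum_(v | G u v)
    (\sum_(S in F) ((u \in S) && (v \in S) : nat))%:R * (2^-1 - x u).
Proof.
under eq_bigr do rewrite weight_pairs.
rewrite exchange_big; apply: eq_bigr => u _ /=.
rewrite exchange_big; apply: eq_bigr => v _ /=.
by rewrite natr_sum mulr_suml.
Qed.

Lemma sum_weight_le : \sum_(S in F) weight S <= weight (cover F).
Proof.
rewrite sum_weight_pairs weight_pairs.
apply: ler_sum => u _; apply: ler_sum => v Guv.
apply: ler_wpM2r; first by have := x_lt u; lra.
by rewrite ler_nat mult_pair.
Qed.

Lemma sum_cost : \sum_(S in F) cost S = \sum_(u in cover F) (mult u)%:R * (1 - x u).
Proof.
rewrite /cost (exchange_big_dep (fun u => u \in cover F)) /=; last first.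
  by move=> S u SF uS; apply/bigcupP; exists S.
apply: eq_bigr => u _; rewrite sumr_const -[in LHS]mulr_natl; congr (_%:R * _).
by apply: eq_card => S; rewrite !inE.
Qed.

Lemma sum_weight : \sum_(S in F) weight S = \sum_(S in F) cost S - #|F|%:R.
Proof.
rewrite -sum1_card natr_sum -sumrB; apply: eq_bigr => S SF.
exact/eqP/F_tight.
Qed.

Lemma mult_gt0 u : u \in cover F -> (0 < mult u)%N.
Proof.
by case/bigcupP=> S SF uS; apply/card_gt0P; exists S; rewrite inE SF.
Qed.

(** A vertex of two members lies in a set of cost < 1, so [x u] is positive there. *)
Lemma mult_pos u : u \notin pos_set -> (mult u <= 1)%N.
Proof.
move=> uf; rewrite leqNgt; apply/negP => /card_gt1P[A [B []]].
rewrite !inE => /andP[AF uA] /andP[BF uB] AB.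
have := cost_lt1_pos (F_disj AF BF AB) (u := u); rewrite inE uA uB => /(_ isT).
by rewrite (negPf uf).
Qed.

Lemma sum_mult_pos :
  (\sum_(S in F) #|S :&: pos_set| = \sum_(u in cover F :&: pos_set) mult u)%N.
Proof.
under eq_bigr do rewrite -sum1_card.
rewrite (exchange_big_dep (fun u => u \in cover F :&: pos_set)) /=; last first.
  move=> S u SF; rewrite !inE => /andP[uS ->]; rewrite andbT.
  by apply/bigcupP; exists S.
apply: eq_bigr => u; rewrite inE => /andP[_ uf]; rewrite sum1dep_card.
by apply: eq_card => S; rewrite !inE; move: uf; rewrite inE => ->; rewrite andbT.
Qed.

Lemma sum_excess_pos :
  \sum_(u in cover F) ((mult u)%:R - 1) * (1 - x u)
    = \sum_(u in cover F :&: pos_set) (mult u).-1%:R * (1 - x u).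
Proof.
rewrite (big_setID pos_set) /= [X in _ + X]big1 ?addr0 => [|u].
  apply: eq_bigr => u; rewrite inE => /andP[/mult_gt0 m0 _].
  by rewrite -subn1 natrB.
rewrite inE => /andP[uf uc].
have -> : mult u = 1%N by apply/eqP; rewrite eqn_leq mult_pos ?mult_gt0.
by rewrite subrr mul0r.
Qed.

Lemma sum_predn_mult :
  (\sum_(S in F) #|S :&: pos_set|
    = \sum_(u in cover F :&: pos_set) (mult u).-1 + #|cover F :&: pos_set|)%N.
Proof.
rewrite sum_mult_pos -sum1_card -big_split; apply: eq_bigr => u /=.
by rewrite inE => /andP[/mult_gt0 m0 _]; rewrite addn1 prednK.
Qed.

(** Total cost minus [#|F|] is the total weight, which is at most the weight of the cover, hence at
    most the cost of the cover minus 1. *)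
Lemma packing_excess_le :
  \sum_(u in cover F :&: pos_set) (mult u).-1%:R * (1 - x u) <= #|F|%:R - 1.
Proof.
have [S SF] := set0Pn _ F_neq0.
have sc : S \subset cover F by apply: bigcup_sup.
have c1 := le_trans (tight_cost (F_tight SF)) (cost_sub sc).
have := weight_le c1; have := sum_weight_le; have := sum_weight.
rewrite sum_cost -sum_excess_pos.
under [in X in _ -> _ -> _ -> X]eq_bigr do rewrite mulrBl mul1r.
rewrite sumrB -/(cost _); lra.
Qed.

Lemma packing_bound : (1 < #|F|)%N ->
  (\sum_(S in F) #|S :&: pos_set| + 3 <= #|cover F :&: pos_set| + 2 * #|F|)%N.
Proof.
move=> F2; rewrite sum_predn_mult.
set D := (\sum_(u in _) _)%N.
(* A positive [D] has a positive term, so [2^-1 < 1 - x u] makes the estimate [D / 2 < #|F| - 1]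
   strict. When [D = 0], the hypothesis [1 < #|F|] is enough. *)
suff : (D = 0)%N \/ (D < 2 * #|F| - 2)%N by lia.
case: (posnP D) => [|D0]; [by left | right].
have : D%:R * 2^-1 < #|F|%:R - 1 :> R.
  apply: lt_le_trans packing_excess_le; rewrite natr_sum mulr_suml.
  have [u uc Du] : exists2 u, u \in cover F :&: pos_set & (0 < (mult u).-1)%N.
    apply/exists_inP; apply: contraLR D0; rewrite negb_exists_in -leqNgt.
    move=> /forall_inP D0.
    by rewrite leqn0 sum_nat_eq0; apply/forall_inP => u /D0; rewrite -leqn0 -leqNgt.
  apply: (@ltr_sum_one _ _ _ _ _ u) => // [w _|].
    by apply: ler_wpM2l; [exact: ler0n | have := x_lt w; lra].
  rewrite ltr_pM2l ?ltr0n //; have := x_lt u; lra.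
move=> H.
have : (D + 2)%:R < (2 * #|F|)%:R :> R by rewrite natrD natrM; lra.
by rewrite ltr_nat; lia.
Qed.

(** * Families that cover every edge of a tight set *)

Section Covering.
Variable T : {set V}.
Hypotheses (tT : tight T) (sFT : {in F, forall S, S \subset T}).
Hypothesis edges_covered : {in T &, forall u v, G u v ->
  exists2 S, S \in F & (u \in S) && (v \in S)}.

Lemma covering_weight : \sum_(S in F) weight S = weight T.
Proof.
have /subsetP sc : cover F \subset T by apply/bigcupsP.
rewrite sum_weight_pairs weight_pairs.
apply: eq_bigr => u _; apply: eq_bigr => v Guv; congr (_%:R * _).
apply/eqP; rewrite eqn_leq; apply/andP; split.
  apply: leq_trans (mult_pair Guv) _.
  by case: andP => // -[uc vc]; rewrite !sc.
case: andP => // -[uT vT]; have [B BF uvB] := edges_covered uT vT Guv.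
by rewrite (bigD1 B) //= uvB.
Qed.

(** The cover already carries the whole weight of [T]. A vertex outside it would add positive cost
    and no weight, contradicting the tightness of [T]. *)
Lemma covering_cover : cover F = T.
Proof.
have sc : cover F \subset T by apply/bigcupsP.
have [S SF] := set0Pn _ F_neq0.
have sSc : S \subset cover F by apply: bigcup_sup.
have c1 := le_trans (tight_cost (F_tight SF)) (cost_sub sSc).
apply/eqP; rewrite eqEsubset sc; apply/subsetP => u uT.
apply: contraT => uc.
have : cost (cover F) + (1 - x u) <= cost T.
  rewrite [leRHS]/cost (big_setID (cover F)) /=.
  have -> : T :&: cover F = cover F by apply/setIidPr.
  rewrite lerD2l (bigD1 u) ?inE ?uc //= lerDl sumr_ge0 // => v _.
  by rewrite ltW ?cost_gt0.
have := cost_gt0 u; have := weight_le c1; have := sum_weight_le.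
rewrite covering_weight; move/eqP: tT; lra.
Qed.

(** The excess inequality is now an equality. On [pos_set] each factor [1 - x u] is below 1, so the
    integer [D] exceeds [#|F| - 1]; some term is nonzero because [#|F| - 1] is positive. *)
Lemma covering_bound : (1 < #|F|)%N ->
  (#|T :&: pos_set| + #|F| <= \sum_(S in F) #|S :&: pos_set|)%N.
Proof.
move=> F2; rewrite sum_predn_mult covering_cover addnC leq_add2r.
have E : \sum_(u in T :&: pos_set) (mult u).-1%:R * (1 - x u) = #|F|%:R - 1.
  have := sum_weight; rewrite sum_cost covering_weight (eqP tT).
  rewrite -covering_cover -sum_excess_pos.
  under [in X in _ -> X]eq_bigr do rewrite mulrBl mul1r.
  rewrite sumrB -/(cost _); lra.
set D := (\sum_(u in _) _)%N.
suff : #|F|%:R - 1 < D%:R :> R.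
  by rewrite ltrBlDr -(natrD _ D 1) ltr_nat addn1 ltnS.
have F2' : 2 <= #|F|%:R :> R by rewrite (ler_nat _ 2).
have [u uc Du] : exists2 u, u \in T :&: pos_set & (0 < (mult u).-1)%N.
  apply/exists_inP; apply: contraTT F2'; rewrite negb_exists_in => /forall_inP D0.
  move: E; rewrite big1 => [E|u /D0]; first by rewrite -ltNge; lra.
  by rewrite -leqNgt leqn0 => /eqP ->; rewrite mul0r.
rewrite -E natr_sum; apply: (@ltr_sum_one _ _ _ _ _ u) => // [w _|].
  by rewrite ler_piMr ?ler0n //; have := x_ge0 w; lra.
move: uc; rewrite !inE => /andP[_ xu].
by rewrite gtr_pMr ?ltr0n //; lra.
Qed.

End Covering.
End Packing.
End Half.
End Weights.

(** * The row space of the tight constraints *)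

Section Span.
Variables (R : realFieldType) (V : finType) (G : sgraph V) (x : V -> R).
Implicit Types (A B S T : {set V}) (u v : V).

Local Notation pos_set := (pos_set x).
Local Notation cost := (cost x).
Local Notation tight := (tight G x).

(** Only the coordinates in the support are kept: a direction along which [x] can move both ways
    vanishes where [x u = 0]. *)
Definition tight_row S : 'rV[R]_#|pos_set| := \row_j coef R G S (enum_val j).

Definition tight_span T : 'M[R]_#|pos_set| :=
  (\sum_(S : {set V} | tight S && (S \subset T)) <<tight_row S>>)%MS.

Lemma tight_row_sub S T : tight S -> S \subset T ->
  (tight_row S <= tight_span T)%MS.
Proof.
move=> tS sST; rewrite -(genmxE (tight_row S)).
by apply: (sumsmx_sup S); rewrite ?tS.
Qed.

Lemma tight_span_sub n T (M : 'M[R]_(n, #|pos_set|)) :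
  (forall S, tight S -> S \subset T -> (tight_row S <= M)%MS) ->
  (tight_span T <= M)%MS.
Proof.
by move=> H; apply/sumsmx_subP => S /andP[tS sST]; rewrite genmxE H.
Qed.

Lemma tight_row_pos0 S : S :&: pos_set = set0 -> tight_row S = 0.
Proof.
move=> Sf; apply/rowP => j; rewrite !mxE /coef; case: ifP => // jS.
by have := in_set0 (enum_val j); rewrite -Sf inE jS enum_valP.
Qed.

Lemma tight_row_edge u v : G u v -> tight_row [set u; v] = 0.
Proof.
move=> Guv; apply/rowP => j; rewrite !mxE /coef; case: ifP => //.
rewrite !inE => /orP[] /eqP ->; first by rewrite induced_degree_edge // subrr.
by rewrite setUC induced_degree_edge ?subrr // adj_sym.
Qed.

Lemma tight_rowUI A B : (forall u, cross G A B u = 0%N) ->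
  tight_row (A :|: B) + tight_row (A :&: B) = tight_row A + tight_row B.
Proof. by move=> c0; apply/rowP => j; rewrite !mxE coefUI c0 addr0. Qed.

Hypotheses (x_ge0 : forall u, 0 <= x u) (x_lt : forall u, x u < 2^-1).
Hypothesis weight_le : forall S, 1 <= cost S -> weight G x S <= cost S - 1.

(** An edge inside [T] is itself tight, so it would equal [T] and have zero row. An edgeless tight
    [T] contains no vertex of [pos_set]. *)
Lemma tight_span_atom T : (forall S, tight S -> S \subset T -> S = T) ->
  tight_span T = 0.
Proof.
move=> atom; apply/eqP; rewrite -submx0.
apply: tight_span_sub => S tS sST; rewrite submx0.
have ST := atom S tS sST; subst S; apply/eqP.
have [/existsP[u /existsP[v /and3P[uT vT Guv]]]|nE] :=
  boolP [exists u, [exists v, [&& u \in T, v \in T & G u v]]].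
  rewrite -(atom _ (tight_edge x Guv)) ?tight_row_edge //.
  by apply/subsetP=> w; rewrite !inE => /orP[] /eqP->.
apply/tight_row_pos0/(tight_edgeless x_lt tS) => u v uT vT.
apply: contra nE => Guv; apply/existsP; exists u; apply/existsP; exists v.
by rewrite uT vT.
Qed.

(** * Induction step through a maximal tight proper subset *)

Section Family.
Variables (T A : {set V}).
Hypotheses (tA : tight A) (sAT : A \proper T).
Hypothesis A_max : forall S, tight S -> S \subset T -> A \subset S ->
  S = A \/ S = T.

Definition transverse S := [&& tight S, S \subset T & cost (S :&: A) < 1].

Definition tight_family : {set {set V}} :=
  A |: [set S | maxset transverse S].

Lemma transverse_family S : transverse S ->
  exists2 B, B \in tight_family & S \subset B.
Proof.
by move=> /maxset_exists[B mB sSB]; exists B => //; rewrite !inE mB orbT.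
Qed.

Lemma family_proper B : B \in tight_family -> tight B /\ B \proper T.
Proof.
rewrite !inE => /orP[/eqP->//|/maxsetp /and3P[tB sBT cB]]; split=> //.
rewrite properEneq sBT andbT; apply: contraTneq cB => ->.
by rewrite (setIidPr (proper_sub sAT)) -leNgt (tight_cost x_lt tA).
Qed.

Lemma tight_union_max S : tight S -> S \subset T -> 1 <= cost (S :&: A) ->
  S :|: A = A \/ S :|: A = T.
Proof.
move=> tS sST cS; have [tU _ _] := tight_uncross x_lt weight_le tS tA cS.
by apply: A_max; rewrite ?subsetUr // subUset sST proper_sub.
Qed.

(* If [B] and [C] met in cost at least 1, then [(B :|: C) :&: A] would be tight;
   its edges would join [B :\: C] to [C :\: B], which uncrossing forbids. *)
Lemma maximal_transverse_disj B C : maxset transverse B -> maxset transverse C ->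
  B != C -> cost (B :&: C) < 1.
Proof.
move=> mB mC BC; rewrite ltNge; apply/negP => cBC.
have /and3P[tB sBT cB] := maxsetp mB; have /and3P[tC sCT cC] := maxsetp mC.
have [tU _ X0] := tight_uncross x_lt weight_le tB tC cBC.
(* Otherwise [B :|: C] is transverse, and maximality identifies both [B] and [C] with it. *)
have cUA : 1 <= cost ((B :|: C) :&: A).
  rewrite leNgt; apply/negP => cU.
  have tr : transverse (B :|: C) by rewrite /transverse tU subUset sBT sCT.
  case/eqP: BC; rewrite -(maxsetsup mB tr (subsetUl _ _)).
  exact: (maxsetsup mC tr (subsetUr _ _)).
have [_ tI _] := tight_uncross x_lt weight_le tU tA cUA.
have nG : {in (B :|: C) :&: A &, forall u v, ~~ G u v}.
  move=> u v; rewrite !inE => /andP[uBC uA] /andP[vBC vA]; apply/negP => Guv.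
  have uv : u != v by apply: contraTneq Guv => ->; rewrite adj_irr.
  have nB : ~~ ((u \in B) && (v \in B)).
    apply: contra uv => /andP[uB vB]; apply/eqP.
    by apply: (cost_lt1_eq x_lt cB); rewrite inE ?uB ?vB.
  have nC : ~~ ((u \in C) && (v \in C)).
    apply: contra uv => /andP[uC vC]; apply/eqP.
    by apply: (cost_lt1_eq x_lt cC); rewrite inE ?uC ?vC.
  have Gvu : G v u by rewrite adj_sym.
  have := cross_eq0 X0 (u := u) (v := v); have := cross_eq0 X0 (u := v) (v := u).
  rewrite !inE Guv Gvu; move: uBC vBC nB nC.
  by case: (u \in B); case: (u \in C); case: (v \in B); case: (v \in C);
    move=> //= ? ? ? ? H1 H2;
    first [by have := H1 isT isT | by have := H2 isT isT].
(* This set avoids [pos_set], yet each of its vertices lies in [B :&: A] or [C :&: A], whose cost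
   below 1 forces positivity. *)
have := tight_edgeless x_lt tI nG.
have /set0Pn[u uU] : (B :|: C) :&: A != set0.
  by apply: contraTneq cUA => ->; rewrite /cost big_set0 -ltNge.
move=> /setP/(_ u); rewrite inE uU inE /=.
move: uU; rewrite !inE => /andP[/orP[uB|uC] uA] /negP[].
  by have := cost_lt1_pos x_ge0 x_lt cB (u := u); rewrite !inE uB uA; apply.
by have := cost_lt1_pos x_ge0 x_lt cC (u := u); rewrite !inE uC uA; apply.
Qed.

Lemma family_disj : {in tight_family &, forall B C, B != C -> cost (B :&: C) < 1}.
Proof.
move=> B C; rewrite !inE => /orP[/eqP->|mB] /orP[/eqP->|mC] BC.
- by rewrite eqxx in BC.
- by rewrite setIC; case/and3P: (maxsetp mC).
- by case/and3P: (maxsetp mB).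
- exact: maximal_transverse_disj.
Qed.

Definition family_span := (\sum_(B in tight_family) tight_span B)%MS.

Lemma family_span_sup B S : B \in tight_family -> tight S -> S \subset B ->
  (tight_row S <= family_span)%MS.
Proof.
move=> BF tS sSB; apply: submx_trans (tight_row_sub tS sSB) _.
exact: (sumsmx_sup B).
Qed.

Lemma A_in_family : A \in tight_family. Proof. exact: setU11. Qed.

(** A transverse [S] lies in a member of the family. Any other [S] uncrosses with [A]: a union [A]
    puts [S] inside [A], and a union [T] trades the row of [S] for that of [T] modulo the family. *)
Lemma tight_row_cases S : tight S -> S \subset T ->
  (tight_row S <= family_span)%MS \/
  S :|: A = T /\ exists2 D : 'rV_#|pos_set|, (D <= family_span)%MS
      & tight_row T = tight_row S + D.
Proof.
move=> tS sST; have [cS|cS] := ltP (cost (S :&: A)) 1.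
  have [|B BF sSB] := @transverse_family S; first by rewrite /transverse tS sST.
  by left; apply: family_span_sup BF tS sSB.
have [_ tI X0] := tight_uncross x_lt weight_le tS tA cS.
have sA := family_span_sup A_in_family tA (subxx _).
have sI := family_span_sup A_in_family tI (subsetIr _ _).
have E := tight_rowUI X0.
have [UA|UT] := tight_union_max tS sST cS.
  left; suff -> : tight_row S = tight_row (S :&: A) by [].
  by move: E; rewrite UA addrC => /addIr.
right; split=> //; exists (tight_row A - tight_row (S :&: A)).
  by rewrite addmx_sub ?eqmx_opp.
by rewrite -UT addrA -E addrK.
Qed.

Lemma tight_span_family : (tight_span T <= family_span + tight_row T)%MS.
Proof.
apply: tight_span_sub => S tS sST.
have [H|[_ [D DF E]]] := tight_row_cases tS sST.
  exact: submx_trans H (addsmxSl _ _).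
have -> : tight_row S = - D + tight_row T by rewrite E addrC addrK.
by rewrite addmx_sub_adds // eqmx_opp.
Qed.

Lemma tight_span_family_nontight : ~~ tight T ->
  (tight_span T <= family_span)%MS.
Proof.
move=> nT; apply: tight_span_sub => S tS sST.
have [//|[UT _]] := tight_row_cases tS sST.
have [cS|cS] := ltP (cost (S :&: A)) 1.
  have [|B BF sSB] := @transverse_family S; first by rewrite /transverse tS sST.
  exact: family_span_sup BF tS sSB.
have [tU _ _] := tight_uncross x_lt weight_le tS tA cS.
by rewrite UT (negPf nT) in tU.
Qed.

(** An edge is a tight set with zero row. If it uncrosses with [A] to give [T], the row of [T] is a
    difference of rows of tight subsets of [A]. *)
Lemma uncovered_edge u v : u \in T -> v \in T -> G u v ->
  (exists2 B, B \in tight_family & (u \in B) && (v \in B)) \/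
  (tight_row T <= family_span)%MS.
Proof.
move=> uT vT Guv; have te := tight_edge x Guv.
have se : [set u; v] \subset T.
  by apply/subsetP=> w; rewrite !inE => /orP[] /eqP->.
have [/transverse_family[B BF /subsetP sB]|ntr] := boolP (transverse [set u; v]).
  by left; exists B => //; rewrite !sB ?inE ?eqxx ?orbT.
have cE : 1 <= cost ([set u; v] :&: A).
  by rewrite leNgt; move: ntr; rewrite /transverse te se.
have [UA|UT] := tight_union_max te se cE.
  left; exists A; first exact: A_in_family.
  by rewrite -UA !inE !eqxx ?orbT.
right; have [_ tI X0] := tight_uncross x_lt weight_le te tA cE.
have sA := family_span_sup A_in_family tA (subxx _).
have sI := family_span_sup A_in_family tI (subsetIr _ _).
have := tight_rowUI X0; rewrite UT tight_row_edge // add0r => /(canRL (addrK _)) ->.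
by rewrite addmx_sub ?eqmx_opp.
Qed.

Hypothesis IH : forall B, B \proper T -> (\rank (tight_span B) <= #|B :&: pos_set| - 2)%N.

(** The other members have zero span by [IH]; on these the truncated subtraction of 2 is exact. *)
Let large := [set B in tight_family | (1 < #|B :&: pos_set|)%N].

Lemma family_span_rank :
  (\rank family_span <= \sum_(B in large) (#|B :&: pos_set| - 2))%N.
Proof.
have le_rank : (\rank family_span <= \sum_(B in tight_family) \rank (tight_span B))%N.
  apply: (big_ind2 (fun M k => (\rank M <= k)%N)) => // [|M k N l Mk Nl].
    by rewrite mxrank0.
  exact: leq_trans (mxrank_adds_leqif M N) (leq_add Mk Nl).
apply: leq_trans le_rank _.
rewrite (big_setID large) /= [X in (_ + X)%N]big1 ?addn0; last first.
  move=> B /setDP[BF]; rewrite [B \in large]inE BF /= -leqNgt => l1.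
  have [_ /IH pB] := family_proper BF; lia.
have -> : tight_family :&: large = large.
  by apply/setIidPr/subsetP => B; rewrite inE => /andP[].
apply: leq_sum => B; rewrite inE => /andP[BF _].
by apply: IH; case: (family_proper BF).
Qed.

Lemma rank_step : (\rank (tight_span T) <= #|T :&: pos_set| - 2)%N.
Proof.
have large_sub : {subset large <= tight_family} by move=> B; rewrite inE => /andP[].
have sumE : (\sum_(B in large) (#|B :&: pos_set| - 2) + 2 * #|large|
    = \sum_(B in large) #|B :&: pos_set|)%N.
  rewrite mulnC -sum_nat_const -big_split; apply: eq_bigr => B /=.
  by rewrite inE => /andP[_ /subnK].
(* With two large members, the 3 in [packing_bound] pays for the row of [T] and for the final
   [- 2]. *)
have [l2|l1] := ltnP 1 #|large|.
  have rk : (\rank (tight_span T) <= \rank family_span + 1)%N.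
    apply: leq_trans (mxrankS tight_span_family) _.
    apply: leq_trans (mxrank_adds_leqif _ _) _.
    by rewrite leq_add2l rank_leq_row.
  have l0 : large != set0 by rewrite -card_gt0 ltnW.
  have lt : {in large, forall S, tight S}.
    by move=> S /large_sub/family_proper[].
  have ld : {in large &, forall B C, B != C -> cost (B :&: C) < 1}.
    by move=> B C /large_sub BF /large_sub CF; apply: family_disj.
  have := packing_bound x_ge0 x_lt weight_le lt ld l0 l2.
  have : (#|cover large :&: pos_set| <= #|T :&: pos_set|)%N.
    apply/subset_leq_card/setSI/bigcupsP => B /large_sub/family_proper[_].
    exact: proper_sub.
  have := family_span_rank; lia.
(* With at most one large member the family already meets the bound, so it remains to show that the
   row of [T] is redundant. *)
have rkF : (\rank family_span <= #|T :&: pos_set| - 2)%N.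
  apply: leq_trans family_span_rank _.
  have [->|[B BL]] := set_0Vmem large; first by rewrite big_set0.
  have -> : large = [set B].
    apply/esym/eqP; rewrite eqEcard sub1set BL cards1; exact: l1.
  rewrite big_set1 leq_sub2r // subset_leq_card // setSI //.
  by have [_ /proper_sub] := family_proper (large_sub _ BL).
suff : (tight_span T <= family_span)%MS.
  by move=> /mxrankS/leq_trans; apply.
have [tT|] := boolP (tight T); last exact: tight_span_family_nontight.
suff rT : (tight_row T <= family_span)%MS.
  by apply: submx_trans tight_span_family _; rewrite addsmx_sub submx_refl.
apply: contraT => nT.
have edges : {in T &, forall u v, G u v ->
    exists2 B, B \in tight_family & (u \in B) && (v \in B)}.
  move=> u v uT vT Guv; have [//|H] := uncovered_edge uT vT Guv.
  by rewrite H in nT.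
have F0 : tight_family != set0 by apply/set0Pn; exists A; exact: A_in_family.
have Ft : {in tight_family, forall S, tight S} by move=> S /family_proper[].
have Fs : {in tight_family, forall S : {set V}, S \subset T}.
  by move=> S /family_proper[_ /proper_sub].
(* A family reduced to [A] would cover [T], although [A] is proper. *)
have F2 : (1 < #|tight_family|)%N.
  rewrite ltnNge; apply/negP => F1.
  have FA : tight_family = [set A].
    by apply/esym/eqP; rewrite eqEcard sub1set A_in_family cards1.
  have := covering_cover x_lt weight_le Ft family_disj F0 tT Fs edges.
  by rewrite FA /cover big_set1 => AT; move: sAT; rewrite AT properxx.
have := covering_bound x_ge0 x_lt weight_le Ft family_disj F0 tT Fs edges F2.
have sumF : (\sum_(S in tight_family) #|S :&: pos_set| + #|large|
    <= \sum_(S in large) #|S :&: pos_set| + #|tight_family|)%N.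
  rewrite -[#|large|]sum1_card -[#|tight_family|]sum1_card.
  rewrite [X in (X + _ <= _)%N](big_setID large) /=.
  rewrite [X in (_ <= _ + X)%N](big_setID large) /=.
  have -> : tight_family :&: large = large.
    exact/setIidPr/subsetP.
  rewrite addnAC [leqRHS]addnA leq_add2l.
  apply: leq_sum => B /setDP[BF].
  by rewrite [B \in large]inE BF /= -leqNgt.
(* Combined with [covering_bound], [sumF] leaves no vertex of [pos_set] in [T] if [large] is empty.
   If [large] is a single [B], it gives [B] more such vertices than [T], which contains it. *)
have [l0|[B BL]] := set_0Vmem large.
  rewrite l0 big_set0 cards0 in sumF => H.
  case/negP: nT; rewrite tight_row_pos0 ?sub0mx //; apply/eqP; rewrite -cards_eq0; lia.
have lB : large = [set B].
  apply/esym/eqP; rewrite eqEcard sub1set BL cards1; exact: l1.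
rewrite lB big_set1 cards1 in sumF => H.
have : (#|B :&: pos_set| <= #|T :&: pos_set|)%N.
  by apply/subset_leq_card/setSI/Fs/large_sub.
lia.
Qed.

End Family.

Lemma tight_span_rank T : (\rank (tight_span T) <= #|T :&: pos_set| - 2)%N.
Proof.
elim: {T}_.+1 {-2}T (ltnSn #|T|) => // n IHn T; rewrite ltnS => leTn.
have IH B : B \proper T -> (\rank (tight_span B) <= #|B :&: pos_set| - 2)%N.
  by move=> /proper_card BT; apply: IHn; apply: leq_trans leTn.
have [/existsP[S0 tS0]|nS] := boolP [exists S, tight S && (S \proper T)]; last first.
  rewrite tight_span_atom ?mxrank0 // => S tS sST; apply/eqP; apply: contraNT nS => ST.
  by apply/existsP; exists S; rewrite tS properEneq ST.
have [A mA _] := maxset_exists (P := fun S => tight S && (S \proper T)) tS0.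
have /andP[tA pA] := maxsetp mA.
apply: (rank_step tA pA _ IH) => S tS sST sAS.
have [->|ST] := eqVneq S T; [by right|left].
by apply: (maxsetsup mA) => //; rewrite tS properEneq ST.
Qed.

End Span.

(** * Perturbing the point within its tight constraints *)

Lemma small_perturbation (R : realFieldType) (I : finType) (P : pred I)
    (a b : I -> R) :
  (forall i, P i -> 0 <= a i) -> (forall i, P i -> a i = 0 -> b i = 0) ->
  exists2 e, 0 < e & forall i, P i -> e * `|b i| <= a i.
Proof.
move=> a_ge0 ab0.
(* The terms with [a i = 0] vanish. *)
pose s := \sum_(i | P i) `|b i| / a i.
have term_ge0 i : P i -> 0 <= `|b i| / a i.
  by move=> /a_ge0 ai; rewrite divr_ge0.
have s_gt0 : 0 < 1 + s by rewrite ltr_pwDl // sumr_ge0.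
(* Each ratio [|b i| / a i] is at most [s], so this one step suits all indices without taking a
   minimum. *)
exists (1 + s)^-1 => [|i Pi]; first by rewrite invr_gt0.
have [ai0|ai0] := eqVneq (a i) 0; first by rewrite ab0 // ai0 normr0 mulr0.
have ai_gt0 : 0 < a i by rewrite lt_def ai0 a_ge0.
rewrite mulrC ler_pdivrMr // mulrC -ler_pdivrMr //.
rewrite /s (bigD1 i) //= addrCA lerDl addr_ge0 // sumr_ge0 // => j /andP[Pj _].
exact: term_ge0.
Qed.

(** After rotating [c] to start at [u], the next and the last vertices are neighbours of [u]; they
    differ since [c] is duplicate-free of length at least 3. *)
Lemma cycle_degree (V : finType) (G : sgraph V) (c : seq V) (u : V) :
  ucycle G c -> (2 < size c)%N -> u \in c ->
  (2 <= induced_degree G [set v in c] u)%N.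
Proof.
move=> /andP[cG cU] c2 uc.
have [i c' Ec] := rot_to uc.
have cG' : cycle G (u :: c') by rewrite -Ec rot_cycle.
have cU' : uniq (u :: c') by rewrite -Ec rot_uniq.
have mc v : (v \in c) = (v \in u :: c') by rewrite -Ec mem_rot.
have : (2 < size (u :: c'))%N by rewrite -Ec size_rot.
case: c' {Ec} cG' cU' mc => [|a [|b d]] //= /and3P[Gua Gab Gbd].
move=> /and4P[_ naB _ _] mc _.
have Glu : G (last b d) u.
  by move: Gbd; rewrite rcons_path => /andP[].
have al : a != last b d by apply: contraNneq naB => ->; apply: mem_last.
have <- : #|[set a; last b d]| = 2%N by rewrite cards2 al.
apply/subset_leq_card/subsetP => v; rewrite !inE mc => /orP[]/eqP->.
  by rewrite Gua !inE eqxx orbT.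
by rewrite adj_sym Glu !in_cons -in_cons mem_last !orbT.
Qed.

Section Perturbation.
Variables (R : realFieldType) (V : finType) (G : sgraph V) (x : V -> R).

Lemma weight_le_of_density :
  (forall u, x u < 2^-1) ->
  (forall S : {set V}, induced_edges G S != set0 ->
     #|induced_edges G S|%:R - #|S|%:R + 1
       <= \sum_(u in S) ((induced_degree G S u)%:R - 1) * x u) ->
  forall S, 1 <= cost x S -> weight G x S <= cost x S - 1.
Proof.
move=> x_lt dens S cS; have [E0|/dens] := eqVneq (induced_edges G S) set0.
  rewrite weight_edgeless ?subr_ge0 // => u v uS vS; apply/negP => Guv.
  have := in_set0 [set u; v]; rewrite -E0 => /negP; apply.
  by apply/imsetP; exists (u, v); rewrite // inE /= uS vS.
have := slackE G x S; lra.
Qed.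

Lemma tight_direction :
  (forall u, 0 <= x u) -> (forall u, x u < 2^-1) ->
  (forall S, 1 <= cost x S -> weight G x S <= cost x S - 1) ->
  pos_set x != set0 ->
  exists f : V -> R, [/\ exists u, f u != 0, forall u, x u = 0 -> f u = 0 &
    forall S, tight G x S ->
      \sum_(u in S) ((induced_degree G S u)%:R - 1) * f u = 0].
Proof.
move=> x_ge0 x_lt wle /set0Pn[u0 u0P].
pose M := tight_span G x setT.
(* The truncated bound [#|pos_set x| - 2] is below the number of columns because the support is
   nonempty. *)
have /rowV0Pn[w wM w0] : kermx M^T != 0.
  rewrite -mxrank_eq0 mxrank_ker mxrank_tr.
  have := tight_span_rank x_ge0 x_lt wle setT; rewrite setTI -/M.
  have : (0 < #|pos_set x|)%N by apply/card_gt0P; exists u0.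
  lia.
pose f u := if u \in pos_set x then w 0 (enum_rank_in u0P u) else 0.
have fE j : f (enum_val j) = w 0 j by rewrite /f enum_valP enum_valK_in.
exists f; split.
- have /rV0Pn[j wj] := w0; by exists (enum_val j); rewrite fE.
- by move=> u xu; rewrite /f inE xu ltxx.
move=> S tS.
have /submxP[D ED] := tight_row_sub tS (subsetT S).
have /sub_kermxP wM0 := wM.
have : tight_row G x S *m w^T = 0.
  by rewrite ED -mulmxA -[M in _ *m (M *m _)]trmxK -trmx_mul wM0 trmx0 mulmx0.
move=> /matrixP/(_ 0 0); rewrite !mxE.
under eq_bigr => j _ do rewrite !mxE -fE.
rewrite -(big_enum_val (fun u => coef R G S u * f u)) /= => E; rewrite -[RHS]E.
rewrite big_mkcond [RHS]big_mkcond; apply: eq_bigr => u _; rewrite /coef /f.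
by case: (u \in S); case: (u \in pos_set x); rewrite ?mulr0 ?mul0r.
Qed.

End Perturbation.

Theorem theorem1 (R : realFieldType) (V : finType) (G : sgraph V)
    (x : {ffun V -> R^o})
    (hcycle : has_cycle G)
    (hx : extreme_point (strong_density G) x) :
  exists u : V, 2^-1 <= x u :> R.
Proof.
apply/existsP; apply: contraT; rewrite negb_exists => /forallP x_lt'.
have x_lt u : x u < 2^-1 :> R by rewrite ltNge x_lt'.
have [[x01 dens] ext] := hx.
have x_ge0 u : 0 <= x u :> R by case/andP: (x01 u).
have wle := weight_le_of_density x_lt dens.
(* The cycle is used here: if [x = 0], its vertex set has cost [#|S|] and, all degrees being at
   least 2, at least that weight. *)
have pos_neq0 : pos_set (x : V -> R) != set0.
  apply/negP => /eqP pos0.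
  have x0 u : x u = 0 :> R.
    apply/eqP; rewrite eq_le x_ge0 andbT leNgt.
    by have := in_set0 u; rewrite -pos0 inE => ->.
  have [c cG c2] := hcycle; pose S := [set v in c].
  have [u uc] : exists u, u \in c by case: (c) c2 => // u d _; exists u; rewrite mem_head.
  have costE : cost x S = #|S|%:R.
    by rewrite /cost -sum1_card natr_sum; apply: eq_bigr => v _; rewrite x0 subr0.
  have : 1 <= cost x S.
    by rewrite costE (ler_nat _ 1) card_gt0; apply/set0Pn; exists u; rewrite inE.
  move=> /wle; rewrite leNgt => /negP; apply.
  suff : cost x S <= weight G x S by lra.
  rewrite costE -sum1_card natr_sum; apply: ler_sum => v; rewrite inE => vc.
  rewrite x0 subr0 ler_pdivlMr ?ltr0n // mul1r (ler_nat _ 2).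
  exact: cycle_degree cG c2 vc.
have [f [[u1 fu1] f0 ftight]] := tight_direction x_ge0 x_lt wle pos_neq0.
pose slack (S : {set V}) : R := \sum_(u in S) ((induced_degree G S u)%:R - 1) * x u
  - (#|induced_edges G S|%:R - #|S|%:R + 1).
pose drift (S : {set V}) : R := \sum_(u in S) ((induced_degree G S u)%:R - 1) * f u.
pose P (i : V + {set V}) := if i is inr T then induced_edges G T != set0 else true.
pose a (i : V + {set V}) : R := match i with inl u => x u | inr T => slack T end.
pose b (i : V + {set V}) : R := match i with inl u => f u | inr T => drift T end.
have [e e_gt0 He] : exists2 e, 0 < e & forall i, P i -> e * `|b i| <= a i.
  apply: small_perturbation => [[u|S] //= /dens|[u|S] //= ES]; first by rewrite subr_ge0.
    exact: f0.
  rewrite /slack -(slackE G (x : V -> R) S) => sl0; apply: ftight.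
  by apply/eqP; lra.
(* The upper bound 1 persists because [|s * f u| <= x u < 1/2]. *)
have feas (s : R) : `|s| = e -> strong_density G [ffun u => (x u + s * f u : R^o)].
  move=> se; split=> [u|S ES].
    have := He (inl u) isT; rewrite /= -se -normrM ler_norml ffunE => /andP[l r].
    have xu := x_lt u; apply/andP; split; lra.
  have := He (inr S) ES; rewrite /= -se -normrM ler_norml => /andP[l r].
  have -> : \sum_(u in S) ((induced_degree G S u)%:R - 1)
      * ([ffun u => (x u + s * f u : R^o)] u : R)
    = \sum_(u in S) ((induced_degree G S u)%:R - 1) * x u + s * drift S :> R.
    rewrite /drift mulr_sumr -big_split; apply: eq_bigr => u _ /=.
    by rewrite ffunE; ring.
  by move: l r; rewrite /slack; lra.
have eN : `|e| = e by rewrite gtr0_norm.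
have meN : `|- e| = e by rewrite normrN.
have half01 : 0 < (2^-1 : R) < 1 by apply/andP; split; lra.
(* [x] is the midpoint of the two perturbed points, so extremality forces [e * f u1 = 0]. *)
have [|/ffunP/(_ u1) + _] := ext _ _ _ (feas e eN) (feas (- e) meN) half01.
  by apply/ffunP => u; rewrite !ffunE /GRing.scale /=; field.
rewrite ffunE => E.
have /eqP : e * f u1 = 0 by apply: (addrI (x u1 : R)); rewrite addr0.
by rewrite mulf_eq0 (gt_eqF e_gt0) (negPf fu1).
Qed.
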